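(* Let $\langle T,S,w,t\rangle$ be an instance of Tree S-partition, where $T$ is a tree, $S\subseteq V(T)$, $w:V(T)\to\mathbb N$ and $t\in\mathbb N$. Let $T'$ be obtained from $T$ by adding, for every $u\in S$, a new vertex $u'$ and the edge $(u,u')$; let $V_s$ be the set of new vertices and $V_d=V(T)$, with $s(u')=t$ for $u'\in V_s$ and $d(v)=w(v)$ for $v\in V_d$. Then $\langle T,S,w,t\rangle$ is a YES instance of Tree S-partition if and only if $\langle T',s,d\rangle$ is a YES instance of Supply-demand tree partition. Moreover, from a supply-demand tree partition of $T'$ a tree S-partition of $T$ with cost at most $t$ can be obtained in $O(|V(T)|)$ time.
   Context: Tree S-partition: given a tree $T$, $w:V(T)\to\mathbb N$, $S\subseteq V(T)$ and $t\in\mathbb N$, decide whether there is a partition of $V(T)$ into sets $V_1,\ldots,V_{|S|}$ such that for each $i$, $T[V_i]$ is connected, $|V_i\cap S|=1$ and $\sum_{v\in V_i}w(v)\le t$ (such a partition is a tree S-partition of cost at most $t$). Supply-demand tree partition: given a tree $T'$ with $V(T')=V_s\uplus V_d$, a supply function $s:V_s\to\mathbb R^+$ and a demand function $d:V_d\to\mathbb R^+$, decide whether there is a partition of $V(T')$ into sets $V_1,\ldots,V_k$, $k=|V_s|$, such that for each $i$, $T'[V_i]$ is connected, $V_i$ contains exactly one vertex $u\in V_s$, and $\sum_{v\in V_i\setminus V_s}d(v)\le s(u)$ (such a partition is a supply-demand tree partition). *)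

(* Defs.v *)
From HB Require Import structures.
From mathcomp Require Import all_boot all_order all_algebra.
From mathcomp Require Import reals.

Set Implicit Arguments.
Unset Strict Implicit.
Unset Printing Implicit Defensive.

Import Order.TTheory GRing.Theory Num.Theory.

Local Open Scope ring_scope.

Record tree := Tree {
  vertex :> finType;
  edge : rel vertex;
  edge_sym : symmetric edge;
  edge_irr : irreflexive edge;
  tree_nonempty : (0 < #|vertex|)%N;
  tree_connected : forall x y : vertex, connect edge x y;
  (* A [ucycle] of size 2 is an edge walked back and forth, so only simple
     closed walks through at least three vertices are graph cycles. *)
  tree_acyclic : forall c : seq vertex, ucycle edge c -> (size c <= 2)%N
}.

Definition induced_connected (T : tree) (B : {set T}) : Prop :=
  {in B &, forall x y,
     connect [rel a b | [&& a \in B, b \in B & edge a b]] x y}.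

Record sp_instance := SpInstance {
  sp_tree : tree;
  sp_S : {set sp_tree};
  sp_w : sp_tree -> nat;
  sp_t : nat
}.

Definition tree_S_partition (I : sp_instance) (P : {set {set sp_tree I}}) : Prop :=
  [/\ partition P [set: sp_tree I], #|P| = #|sp_S I| &
      {in P, forall B : {set sp_tree I},
         [/\ induced_connected B,
             #|B :&: sp_S I| = 1%N &
             (\sum_(v in B) sp_w v <= sp_t I)%N]}].

Definition sp_yes (I : sp_instance) : Prop :=
  exists P : {set {set sp_tree I}}, tree_S_partition P.

(* V_d is the complement of V_s; [sd_s] and [sd_d] are only meaningful on V_s
   and V_d respectively.  Their values are nonnegative rather than positive,
   because weights and capacities of the other problem are naturals and may
   vanish. *)
Record sd_instance (R : realType) := SdInstance {
  sd_tree : tree;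
  sd_Vs : {set sd_tree};
  sd_s : sd_tree -> R;
  sd_d : sd_tree -> R;
  sd_s_ge0 : {in sd_Vs, forall u, 0 <= sd_s u};
  sd_d_ge0 : {in ~: sd_Vs, forall v, 0 <= sd_d v}
}.

Definition supply_demand_partition (R : realType) (J : sd_instance R)
    (Q : {set {set sd_tree J}}) : Prop :=
  [/\ partition Q [set: sd_tree J], #|Q| = #|sd_Vs J| &
      {in Q, forall B : {set sd_tree J},
         induced_connected B /\
         exists2 u, B :&: sd_Vs J = [set u] &
                    \sum_(v in B :\: sd_Vs J) sd_d v <= sd_s u}].

Definition sd_yes (R : realType) (J : sd_instance R) : Prop :=
  exists Q : {set {set sd_tree J}}, supply_demand_partition Q.

Section Reduction.
Variables (T : tree) (S : {set T}).

(* [inr u] is the new pendant vertex u' attached to u. *)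
Definition pendant_vertex : finType := (T + {u : T | u \in S})%type.

Definition pendant_edge : rel pendant_vertex := fun x y =>
  match x, y with
  | inl a, inl b => edge a b
  | inl a, inr u => a == val u
  | inr u, inl a => a == val u
  | inr _, inr _ => false
  end.

Lemma pendant_edge_sym : symmetric pendant_edge.
Proof. by move=> [a|u] [b|v] //=; rewrite edge_sym. Qed.

Lemma pendant_edge_irr : irreflexive pendant_edge.
Proof. by move=> [a|u] //=; rewrite edge_irr. Qed.

Lemma pendant_nonempty : (0 < #|pendant_vertex|)%N.
Proof. by rewrite card_sum addn_gt0 tree_nonempty. Qed.

Lemma pendant_connected (x y : pendant_vertex) : connect pendant_edge x y.
Proof.
have csym : connect_sym pendant_edge by apply/sym_connect_sym/pendant_edge_sym.
have cT (a b : T) : connect pendant_edge (inl a) (inl b).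
  have /connectP[p ep ->] := tree_connected a b.
  elim: p a ep => [|c p IHp] a /=; first by rewrite connect0.
  case/andP=> eac ecp.
  exact: connect_trans (@connect1 _ pendant_edge (inl a) (inl c) eac) (IHp c ecp).
have base (z : pendant_vertex) : exists a : T, connect pendant_edge z (inl a).
  case: z => [a|u]; first by exists a; rewrite connect0.
  by exists (val u); apply: connect1; rewrite /= eqxx.
have [a xa] := base x; have [b yb] := base y.
by apply: connect_trans xa _; apply: connect_trans (cT a b) _; rewrite csym.
Qed.

Lemma pendant_acyclic (c : seq pendant_vertex) :
  ucycle pendant_edge c -> (size c <= 2)%N.
Proof.
case/andP=> cyc uc; rewrite leqNgt; apply/negP=> sc.
have noR u : inr u \notin c.
  apply/negP=> uc'; have [i c' rc] := rot_to uc'.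
  have: cycle pendant_edge (inr u :: c') by rewrite -rc rot_cycle.
  have: uniq (inr u :: c') by rewrite -rc rot_uniq.
  have: (2 < size (inr u :: c'))%N by rewrite -rc size_rot.
  case: c' {rc} => [|x c'] //=; case/lastP: c' => [|c' y] //= _.
  case/and3P=> _ xy _ /andP[ux]; rewrite rcons_path last_rcons => /andP[_ yu].
  move: xy ux yu; rewrite mem_rcons inE negb_or => /andP[xy _].
  case: x y xy => [a|v] [b|v'] //= ab /eqP ea /eqP eb.
  by rewrite ea eb eqxx in ab.
have [c' dc] : exists c' : seq T, c = map inl c'.
  elim: c noR {cyc uc sc} => [|[a|u] c IHc] noR; first by exists [::].
    have [u|c' ->] := IHc; last by exists (a :: c').
    by have := noR u; rewrite inE.
  by have := noR u; rewrite inE eqxx.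
suff: (size c' <= 2)%N by move: sc; rewrite dc size_map ltnNge => /negbTE->.
apply: tree_acyclic; rewrite /ucycle /ucycleb.
rewrite dc map_inj_uniq in uc; last by move=> a b [].
rewrite uc andbT; move: cyc; rewrite dc.
by case: c' {dc uc} => //= a p; rewrite -map_rcons path_map.
Qed.

Definition pendant_tree : tree :=
  Tree pendant_edge_sym pendant_edge_irr pendant_nonempty
       pendant_connected pendant_acyclic.

End Reduction.

Section ReductionInstance.
Variables (R : realType) (I : sp_instance).

Let T' := pendant_tree (sp_S I).

Definition red_Vs : {set T'} :=
  [set x : T' | if (x : pendant_vertex (sp_S I)) is inr _ then true else false].

Definition red_s (x : T') : R :=
  match (x : pendant_vertex (sp_S I)) with
  | inl _ => 0
  | inr _ => (sp_t I)%:R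
  end.

Definition red_d (x : T') : R :=
  match (x : pendant_vertex (sp_S I)) with
  | inl v => (sp_w v)%:R
  | inr _ => 0
  end.

Lemma red_s_ge0 : {in red_Vs, forall u, 0 <= red_s u}.
Proof. by case=> [v|u] _ /=. Qed.

Lemma red_d_ge0 : {in ~: red_Vs, forall v, 0 <= red_d v}.
Proof. by case=> [v|u] _ /=. Qed.

Definition reduction : sd_instance R := SdInstance red_s_ge0 red_d_ge0.

Definition old_vertex (v : sp_tree I) : sd_tree reduction :=
  (inl v : pendant_vertex (sp_S I)).

End ReductionInstance.

(* Running time is measured on a random access machine: registers and a
   fixed number of arrays, all holding naturals, unit cost per instruction
   and per test.  The only arithmetic is +1 and -1, so apart from the
   literals of the program the largest stored number grows by at most one per
   step and unit cost is not distorted by large numbers. *)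
Inductive test :=
  | Lt of nat & nat
  | Eq of nat & nat.

Inductive prog :=
  | Const of nat & nat
  | Move of nat & nat
  | Incr of nat
  | Decr of nat
  | Read of nat & nat & nat
  | Write of nat & nat & nat
  | Seq of prog & prog
  | If of test & prog & prog
  | While of test & prog.

Record state := State {
  reg : nat -> nat;
  arr : nat -> nat -> nat
}.

Definition upd (A : Type) (f : nat -> A) (i : nat) (x : A) : nat -> A :=
  fun j => if j == i then x else f j.

Definition set_reg (m : state) (r x : nat) : state :=
  State (upd (reg m) r x) (arr m).

Definition set_arr (m : state) (a i x : nat) : state :=
  State (reg m) (upd (arr m) a (upd (arr m a) i x)).

Definition eval_test (m : state) (b : test) : bool :=
  match b with
  | Lt r1 r2 => (reg m r1 < reg m r2)%N
  | Eq r1 r2 => reg m r1 == reg m r2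
  end.

(* [exec p m c m']: started in [m], the program [p] halts in [m'] after
   exactly [c] steps. *)
Inductive exec : prog -> state -> nat -> state -> Prop :=
  | ExecConst m r x : exec (Const r x) m 1 (set_reg m r x)
  | ExecMove m r r1 : exec (Move r r1) m 1 (set_reg m r (reg m r1))
  | ExecIncr m r : exec (Incr r) m 1 (set_reg m r (reg m r).+1)
  | ExecDecr m r : exec (Decr r) m 1 (set_reg m r (reg m r).-1)
  | ExecRead m r a i : exec (Read r a i) m 1 (set_reg m r (arr m a (reg m i)))
  | ExecWrite m a i r : exec (Write a i r) m 1 (set_arr m a (reg m i) (reg m r))
  | ExecSeq p1 p2 m m1 m2 c1 c2 :
      exec p1 m c1 m1 -> exec p2 m1 c2 m2 -> exec (Seq p1 p2) m (c1 + c2)%N m2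
  | ExecIf b p1 p2 m m1 c :
      exec (if eval_test m b then p1 else p2) m c m1 ->
      exec (If b p1 p2) m c.+1 m1
  | ExecWhileEnd b p m : eval_test m b = false -> exec (While b p) m 1 m
  | ExecWhileLoop b p m m1 m2 c1 c2 :
      eval_test m b -> exec p m c1 m1 -> exec (While b p) m1 c2 m2 ->
      exec (While b p) m (c1 + c2).+1%N m2.

Definition encodes_partition (V : finType) (P : {set {set V}}) (f : V -> nat) : Prop :=
  (forall v, (f v < #|P|)%N) /\
  (forall u v, f u = f v <-> pblock P u = pblock P v).

Definition r_size := 0%N.
Definition a_off := 0%N.
Definition a_adj := 1%N.
Definition a_supply := 2%N.
Definition a_value := 3%N.
Definition a_block := 4%N.
Definition a_out := 5%N.

(* Input format: the vertices are numbered 0, ..., |V|-1 by [num]; the graph is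
   stored as adjacency lists concatenated in [a_adj], in arbitrary order within
   each list, the list of vertex i starting at index [a_off][i]. *)
Record encodes_input (R : realType) (J : sd_instance R) (Q : {set {set sd_tree J}})
    (num : sd_tree J -> nat) (m : state) : Prop := EncodesInput {
  enc_num_inj : injective num;
  enc_num_lt : forall x, (num x < #|sd_tree J|)%N;
  enc_size : reg m r_size = #|sd_tree J|;
  enc_off0 : arr m a_off 0 = 0%N;
  enc_off : forall x, arr m a_off (num x).+1 =
                      (arr m a_off (num x) + #|edge x|)%N;
  enc_adj : forall x,
    perm_eq [seq arr m a_adj (arr m a_off (num x) + j)%N | j <- iota 0 #|edge x|]
            [seq num y | y <- enum (edge x)];
  enc_supply : forall x, arr m a_supply (num x) = (x \in sd_Vs J);
  enc_value : forall x, (arr m a_value (num x))%:R =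
                        (if x \in sd_Vs J then sd_s x else sd_d x);
  enc_block : encodes_partition Q (fun x => arr m a_block (num x));
  enc_reg0 : forall r, r != r_size -> reg m r = 0%N;
  enc_arr0 : forall a i, (a_block < a)%N -> arr m a i = 0%N
}.

(* Main.v *)
Require Import Defs.
From mathcomp Require Import all_boot all_order all_algebra.
From mathcomp Require Import reals zify.

(** A tree S-partition of T extends to T' by putting every pendant vertex into
    the block of its neighbour.  Conversely, deleting the pendant vertices from
    a supply-demand partition Q is not enough: a block may be a single pendant
    vertex u', and then u lies in a block that contains several vertices of S.
    Such blocks are split by a search from all of S at once that never leaves a
    block of Q: each u in S starts with the label of the block of u', and an
    unlabelled vertex takes the label of the neighbour that discovers it.  The
    labels of distinct sources differ because a block holds one pendant vertex,
    each label class is connected and lies inside a block of Q, and the search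
    reaches everything since each block of Q meets S or is a single pendant
    vertex.  The search is linear because the degrees of a tree sum to at most
    2|V|. *)

Set Implicit Arguments.
Unset Strict Implicit.
Unset Printing Implicit Defensive.

Import Order.TTheory GRing.Theory Num.Theory.

(** * Degree sums in acyclic graphs *)

Section Forest.
Variables (V : finType) (e : rel V).
Hypotheses (e_sym : symmetric e) (e_irr : irreflexive e).
Hypothesis e_acyclic : forall c : seq V, ucycle e c -> size c <= 2.

(** If every vertex of [A] had two neighbours in [A], a simple path in [A] could always be prolonged
    at its head without turning back; a repeated vertex would close a cycle, so simple paths would
    grow beyond [#|V|]. *)
Lemma acyclic_has_leaf (A : {set V}) :
  A != set0 -> exists2 x, x \in A & #|[set y in A | e x y]| <= 1.
Proof.
move=> /set0Pn[x0 x0A]; apply/exists_inP; apply: contraT.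
rewrite negb_exists_in => /forall_inP nleaf.
have next x z : x \in A -> exists2 y, y \in A & e x y && (y != z).
  move=> /nleaf; rewrite -ltnNge => /card_gt1P[y1 [y2 []]].
  rewrite !inE => /andP[y1A xy1] /andP[y2A xy2] ne12.
  have [y1z|y1z] := eqVneq y1 z; last by exists y1; rewrite ?xy1.
  by exists y2; rewrite // xy2 -y1z eq_sym.
have long k : exists x s,
    [/\ x \in A, path e x s, uniq (x :: s) & size s = k].
  elim: k => [|k [x [s [xA es us ss]]]]; first by exists x0, [::].
  (* The vertex to avoid is the predecessor of [x] on the path; for the path of length 0 the default
     [x] excludes nothing that irreflexivity does not exclude. *)
  have [y yA /andP[xy yz]] := next x (head x s) xA.
  exists y, (x :: s); split=> //=; first by rewrite e_sym xy.
    rewrite -/(uniq (x :: s)) us andbT inE negb_or.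
    have -> /= : y != x by apply: contraTneq xy => ->; rewrite e_irr.
    apply/negP => ys; case: s es us ss yz ys => // z s es us _ /= yz.
    rewrite inE (negPf yz) /= => ys.
    move: es us; case/splitPr: ys => s1 s2 /= /andP[xz].
    rewrite -cat_rcons cat_path => /andP[zs1 _].
    rewrite -!(cat_cons, cons_uniq) cat_uniq => /andP[us1 _].
    (* A second visit to [y], beyond [z], closes a cycle through at least the three vertices [x],
       [z] and [y]. *)
    have /e_acyclic : ucycle e (x :: z :: rcons s1 y).
      by rewrite /ucycle /ucycleb us1 /= rcons_path last_rcons xz zs1 e_sym xy.
    by rewrite /= size_rcons.
  by rewrite ss.
have [x [s [_ _ us ss]]] := long #|V|.
by move: (max_card (mem (x :: s))); rewrite (card_uniqP us) /= ss ltnn.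
Qed.

(** Induction by deleting a leaf: its at most one edge is counted once at the leaf and once at its
    neighbour, so the sum drops by at most 2. *)
Lemma acyclic_sum_degree (A : {set V}) :
  \sum_(x in A) #|[set y in A | e x y]| <= 2 * #|A|.
Proof.
have [k] := ubnP #|A|; elim: k A => // k IHk A leAk.
have [->|nzA] := eqVneq A set0; first by rewrite big_set0.
have [x xA leaf] := acyclic_has_leaf nzA.
have cA := cardsD1 x A; rewrite xA in cA.
have IH : \sum_(y in A :\ x) #|[set z in A :\ x | e y z]| <= 2 * #|A :\ x|.
  by apply: IHk; lia.
rewrite (big_setD1 x) //=.
have -> : \sum_(y in A :\ x) #|[set z in A | e y z]| =
   \sum_(y in A :\ x) (e x y : nat) +
   \sum_(y in A :\ x) #|[set z in A :\ x | e y z]|.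
  rewrite -big_split /=; apply: eq_bigr => y _.
  rewrite (cardsD1 x) inE xA e_sym; congr (_ + #|pred_of_set _|).
  by apply/setP=> z; rewrite !inE andbA.
have : \sum_(y in A :\ x) (e x y : nat) <= #|[set y in A | e x y]|.
  rewrite -big_mkcondr /= sum1_card; apply: subset_leq_card.
  by apply/subsetP=> y; rewrite unfold_in !inE => /andP[/andP[_ ->] ->].
lia.
Qed.

End Forest.

Lemma tree_sum_degree (T : tree) : \sum_(x : T) #|edge x| <= 2 * #|T|.
Proof.
have := acyclic_sum_degree (@edge_sym T) (@edge_irr T) (@tree_acyclic T) [set: T].
rewrite cardsT; apply: leq_trans; rewrite big_mkcond [leqRHS]big_mkcond /=.
apply: leq_sum => x _; rewrite inE; apply: subset_leq_card.
by apply/subsetP=> y; rewrite !inE.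
Qed.

(** * Partitions into the fibres of a function, and invariants of connectivity *)

Section PreimPartition.
Variables (V : finType) (K : eqType) (f : V -> K).

Lemma preim_partitionT : partition (preim_partition f setT) setT.
Proof. exact: preim_partitionP. Qed.

Lemma pblock_preim_partition (x : V) :
  pblock (preim_partition f setT) x = [set y | f y == f x].
Proof.
have eqR : {in setT & &, equivalence_rel [rel x y | f x == f y]}.
  by move=> a b c _ _ _ /=; split=> // /eqP ->.
by apply/setP=> y; rewrite (pblock_equivalence_partition eqR) ?inE // eq_sym.
Qed.

Lemma mem_preim_partition (B : {set V}) : B \in preim_partition f setT ->
  exists x, B = [set y | f y == f x].
Proof.
move=> BP; have /and3P[_ tP nz] := preim_partitionT.
have /set0Pn[x xB] : B != set0 by apply: contraNneq nz => <-.
by exists x; rewrite -(def_pblock tP BP xB) pblock_preim_partition.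
Qed.

Lemma pblock_preim_eq x y :
  f x = f y <->
  pblock (preim_partition f setT) x = pblock (preim_partition f setT) y.
Proof.
rewrite !pblock_preim_partition; split=> [->//|/setP/(_ x)].
by rewrite !inE eqxx => /esym/eqP.
Qed.

End PreimPartition.

Lemma card_preim_partition (V K : finType) (f : V -> K) :
  #|preim_partition f setT| = #|f @: setT|.
Proof.
have inj : {in f @: setT &, injective (fun k => [set y | f y == k])}.
  move=> _ _ /imsetP[x _ ->] /imsetP[y _ ->] /setP/(_ x).
  by rewrite !inE eqxx => /esym/eqP.
rewrite -(card_in_imset inj); congr #|pred_of_set _|.
apply/setP=> B; apply/idP/imsetP => [/mem_preim_partition[x ->]|[_ /imsetP[x _ ->] ->]].
  by exists (f x); rewrite // imset_f.
rewrite -pblock_preim_partition; apply: pblock_mem.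
by rewrite (cover_partition (preim_partitionT f)).
Qed.

Lemma mem_pblock_partitionT (V : finType) (P : {set {set V}}) (x : V) :
  partition P setT -> x \in pblock P x.
Proof. by move=> /cover_partition; rewrite mem_pblock => ->. Qed.

Lemma pblock_mem_partitionT (V : finType) (P : {set {set V}}) (x : V) :
  partition P setT -> pblock P x \in P.
Proof. by move=> /cover_partition cP; rewrite pblock_mem ?cP. Qed.

Lemma connect_invariant (V : finType) (e : rel V) (A : pred V) x y :
  (forall a b, A a -> e a b -> A b) -> A x -> connect e x y -> A y.
Proof.
move=> clA Ax /connectP[p ep ->].
elim: p x Ax ep => //= z p IHp x Ax /andP[xz]; apply: IHp.
exact: clA xz.
Qed.

Lemma induced_connect_sym (T : tree) (B : {set T}) :
  connect_sym [rel a b | [&& a \in B, b \in B & edge a b]].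
Proof. by apply: sym_connect_sym => a b /=; rewrite andbCA edge_sym. Qed.

(** * The vertices of the tree with pendants, and their demand *)

Section Pendants.
Variables (R : realType) (I : sp_instance).

Let T := sp_tree I.
Let S : {set T} := sp_S I.
Let J := reduction R I.

Definition new_vertex (u : {u : sp_tree I | u \in sp_S I}) :
  sd_tree (reduction R I) := (inr u : pendant_vertex (sp_S I)).

(** The retraction that collapses every pendant edge; the extended partition consists of the
    preimages of the blocks under it. *)
Definition base_vertex (x : sd_tree (reduction R I)) : sp_tree I :=
  match (x : pendant_vertex (sp_S I)) with inl v => v | inr u => val u end.

Lemma old_vertex_inj : injective (@old_vertex R I).
Proof. by move=> a b []. Qed.

Lemma new_vertex_inj : injective new_vertex.
Proof. by move=> a b []. Qed.

Lemma old_notin_Vs v : (old_vertex R v \in sd_Vs J) = false.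
Proof. by rewrite inE. Qed.

Lemma card_Vs : #|sd_Vs J| = #|S|.
Proof.
have -> : sd_Vs J = new_vertex @: [set: {u : T | u \in S}].
  apply/setP=> -[v|u]; rewrite inE /=.
    by apply/esym/negP=> /imsetP[].
  by apply/esym/imsetP; exists u; rewrite ?in_setT.
by rewrite card_imset ?cardsT ?card_sig //; apply: new_vertex_inj.
Qed.

(** Turns a time bound in the size of T' into one in the size of T. *)
Lemma card_reduction_tree : #|sd_tree J| <= 2 * #|T|.
Proof. by rewrite card_sum card_sig mul2n -addnn leq_add2l max_card. Qed.

Lemma sum_demand (B : {set sd_tree J}) :
  (\sum_(v in B :\: sd_Vs J) sd_d v)%R =
  (\sum_(v : T | old_vertex R v \in B) sp_w v)%:R%R :> R.
Proof.
rewrite big_sumType /= [X in (_ + X)%R]big1 ?addr0 => [|u]; last by rewrite !inE.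
by rewrite natr_sum; apply: eq_bigl => v; rewrite !inE.
Qed.

(** * From a tree S-partition to a supply-demand partition *)

Section Extend.
Variable P : {set {set sp_tree I}}.
Hypothesis P_part : tree_S_partition P.

(** Paths inside a block of [P] remain paths, and a pendant vertex is one edge away from its base.
    The only vertex of [S] in a block yields the only pendant vertex of its preimage. *)
Lemma extended_partition :
  supply_demand_partition (J := J)
    (preim_partition (fun x => pblock P (base_vertex x)) setT).
Proof.
have [pP cP BP] := P_part; have tP : trivIset P by case/and3P: pP.
set f := fun x => pblock P (base_vertex x).
split; first exact: preim_partitionT.
  rewrite card_Vs card_preim_partition -[RHS]cP; congr #|pred_of_set _|.
  apply/setP=> B; apply/imsetP/idP => [[x _ ->]|PB].
    exact: pblock_mem_partitionT.
  have /set0Pn[x xB] : B != set0.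
    by case/and3P: pP => _ _; apply: contraNneq => <-.
  by exists (old_vertex R x) => //; rewrite /f (def_pblock tP PB).
move=> _ /mem_preim_partition[x ->]; set B := [set y | _].
have PB0 : f x \in P by exact: pblock_mem_partitionT.
have [cB0 /eqP/cards1P[u0 SB0] wB0] := BP _ PB0.
have inB y : (y \in B) = (base_vertex y \in f x).
  rewrite inE; apply/eqP/idP => [<-|yB0]; first exact: mem_pblock_partitionT.
  by rewrite {1}/f (def_pblock tP PB0).
split.
  rewrite /induced_connected; set r := [rel a b | _].
  have rsym : connect_sym r by exact: induced_connect_sym.
  have old_conn a b : a \in f x -> b \in f x ->
      connect r (old_vertex R a) (old_vertex R b).
    move=> aB bB; have /connectP[p ep ->] := cB0 a b aB bB.
    elim: p a {aB} ep => [|c p IHp] a //= /andP[/and3P[aB cB eac] /IHp].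
    by apply: connect_trans; apply: connect1; rewrite /= !inB aB cB.
  have base_conn y : y \in B -> connect r y (old_vertex R (base_vertex y)).
    case: y => [v|u] yB //; apply: connect1.
    by rewrite /= yB inB eqxx andbT; rewrite inB in yB.
  move=> y z yB zB; apply: connect_trans (base_conn y yB) _.
  rewrite rsym in base_conn *; apply: connect_trans (base_conn z zB) _.
  by apply: old_conn; rewrite -inB.
have u0B : u0 \in f x :&: S by rewrite SB0 set11.
move: (u0B); rewrite inE => /andP[u0f u0S].
exists (new_vertex (exist _ u0 u0S)).
  apply/setP=> -[v|u]; rewrite in_setI inB !inE /=.
    by rewrite andbF.
  rewrite andbT (inj_eq new_vertex_inj) -val_eqE /=.
  by have /setP/(_ (val u)) := SB0; rewrite !inE (valP u) andbT.
rewrite sum_demand /= ler_nat; apply: leq_trans wB0.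
by apply: eq_leq; apply: eq_bigl => v; rewrite inB.
Qed.

End Extend.

Lemma sp_yes_reduction : sp_yes I -> sd_yes J.
Proof. by case=> P /extended_partition; eexists; eauto. Qed.

(** * From a supply-demand partition to a tree S-partition by spreading labels *)

Section Relabel.
Variables (Q : {set {set sd_tree (reduction R I)}}).
(** The numbering of the blocks is kept abstract: it is an index in an enumeration of [Q] for the
    equivalence, and the content of the input array for the program. *)
Variable blk : sd_tree (reduction R I) -> nat.
Hypotheses (Q_part : supply_demand_partition Q).
Hypothesis blkP : encodes_partition Q blk.

Let ob v := blk (old_vertex R v).
Let nb u := blk (new_vertex u).

Lemma blk_mem x y : (blk y == blk x) = (y \in pblock Q x).
Proof.
have [pQ _ _] := Q_part; have /and3P[_ tQ _] := pQ.
apply/eqP/idP => [/blkP.2 <-|yx]; first exact: mem_pblock_partitionT.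
apply/blkP.2; apply: def_pblock => //; exact: pblock_mem_partitionT.
Qed.

Lemma block_supply x : exists2 u,
  pblock Q x :&: sd_Vs J = [set new_vertex u] &
  \sum_(v : T | ob v == blk x) sp_w v <= sp_t I.
Proof.
have [pQ _ /(_ _ (pblock_mem_partitionT x pQ))[_ [u Vu]]] := Q_part.
have : u \in sd_Vs J.
  by have := set11 u; rewrite -Vu inE => /andP[].
case: u Vu => [v|u] Vu; first by rewrite old_notin_Vs.
move=> _ sumB; exists u => //; move: sumB; rewrite sum_demand ler_nat.
by apply: leq_trans; apply: eq_leq; apply: eq_bigl => v; rewrite blk_mem.
Qed.

Lemma new_blk_inj : injective nb.
Proof.
move=> u u' /eqP; rewrite blk_mem => uu'.
have [pQ _ _] := Q_part.
have [z /setP Vz _] := block_supply (new_vertex u').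
have := Vz (new_vertex u); rewrite !inE uu' => /esym/eqP/new_vertex_inj ->.
have := Vz (new_vertex u'); rewrite !inE mem_pblock_partitionT //.
by move=> /esym/eqP/new_vertex_inj.
Qed.

(** Each block contains a pendant vertex, from which a path inside the block leads to any [v] in it.
    Along the path every old vertex is in [A]: it is entered from a pendant vertex, hence lies in
    [S], or from an old vertex of the same block. *)
Lemma block_closed_full (A : {set T}) : S \subset A ->
  (forall a b, a \in A -> edge a b -> ob a = ob b -> b \in A) -> A = setT.
Proof.
move=> /subsetP SA clA; apply/setP=> v; rewrite inE.
have [u /setP Vu _] := block_supply (old_vertex R v).
have [pQ _ /(_ _ (pblock_mem_partitionT (old_vertex R v) pQ))[cB _]] := Q_part.
have uB : new_vertex u \in pblock Q (old_vertex R v).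
  by have := Vu (new_vertex u); rewrite !inE eqxx => /andP[].
have := cB _ _ uB (mem_pblock_partitionT _ pQ).
move/(connect_invariant (A := fun x : sd_tree J =>
  if (x : pendant_vertex S) is inl a then a \in A else true)); apply=> //.
case=> [a|w] [b|w'] //= aA /and3P[].
  rewrite -!blk_mem => /eqP ea /eqP eb ab; apply: clA ab _ => //.
  by rewrite /ob /old_vertex ea eb.
by move=> _ _ /eqP ->; apply: SA; apply: valP.
Qed.

(* The relabelling in progress: the vertices of [A] have received a label, the
   label of [u] in [S] is the block of its pendant vertex, and every label has
   spread from its source along edges inside a block of [Q]. *)
Definition spread_step (A : {set sp_tree I}) (lab : sp_tree I -> nat) :=
  [rel a b | [&& a \in A, b \in A, lab a == lab b, ob a == ob b & edge a b]].

Definition spread (A : {set sp_tree I}) (lab : sp_tree I -> nat) : Prop :=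
  (forall u, val u \in A /\ lab (val u) = nb u) /\
  (forall v, v \in A -> exists u : {u : T | u \in S},
     connect (spread_step A lab) (val u) v).

(** Labels stored in memory agree with an updated labelling only pointwise. *)
Lemma eq_spread A lab lab' :
  lab =1 lab' -> spread A lab -> spread A lab'.
Proof.
move=> eql [srcA connA]; split=> [u|v /connA[u]].
  by rewrite -eql.
exists u; rewrite -(eq_connect (e := spread_step A lab)) // => a b /=.
by rewrite !eql.
Qed.

Lemma spread_source lab :
  (forall u, lab (val u) = nb u) -> spread S lab.
Proof.
move=> labS; split=> [u|v vS]; first by split; [apply: valP|].
by exists (exist _ v vS); apply: connect0.
Qed.

(** One discovery of the search. Labels inside [A] do not change because [y] is outside, so old
    connections survive, and the edge from [x] joins [y] to the source of [x]. *)
Lemma spread_extend A lab x y :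
  spread A lab -> x \in A -> y \notin A -> edge x y -> ob x = ob y ->
  spread (y |: A) (fun v => if v == y then lab x else lab v).
Proof.
move=> [srcA connA] xA yA exy bxy.
have neqA a : a \in A -> (a == y) = false.
  by move=> aA; apply/negbTE; apply: contraNneq yA => <-.
have sub : subrel (connect (spread_step A lab)) (connect (spread_step (y |: A)
    (fun v => if v == y then lab x else lab v))).
  apply: connect_sub => a b /and5P[aA bA ab oab eab]; apply: connect1.
  by rewrite /= !inE aA bA !orbT !neqA // ab oab eab.
split=> [u|v]; first by have [uA ->] := srcA u; rewrite inE uA orbT neqA.
have [u /sub ux] := connA x xA.
rewrite !inE => /orP[/eqP ->|/connA[w /sub]]; last by exists w.
exists u; apply: connect_trans ux _; apply: connect1.
by rewrite /= !inE eqxx xA orbT bxy exy neqA // !eqxx.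
Qed.

Lemma spread_closed_full A lab : spread A lab ->
  (forall a b, a \in A -> edge a b -> ob a = ob b -> b \in A) -> A = setT.
Proof.
move=> [srcA _]; apply: block_closed_full; apply/subsetP=> u uS.
by case: (srcA (exist _ u uS)).
Qed.

(** Label and block of [Q] are both constant along spreading steps, and sources have distinct
    labels. A label class is thus what one source reaches: it is connected, has one vertex of [S],
    and lies in one block. *)
Lemma spread_tree_S_partition lab : spread setT lab ->
  tree_S_partition (preim_partition lab setT) /\
  encodes_partition (preim_partition lab setT) lab.
Proof.
move=> [srcL connL].
have labS u : lab (val u) = nb u by case: (srcL u).
have step_const a b : connect (spread_step setT lab) a b ->
    lab b = lab a /\ ob b = ob a.
  move=> ab.
  have : [pred z | (lab z == lab a) && (ob z == ob a)] b.
    apply: connect_invariant ab; last by rewrite /= !eqxx.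
    move=> c d /= /andP[/eqP <- /eqP <-] /and5P[_ _ /eqP -> /eqP ->].
    by rewrite !eqxx.
  by move=> /andP[/eqP-> /eqP->].
have src v : exists u : {u : T | u \in S},
    [/\ connect (spread_step setT lab) (val u) v, lab v = nb u & ob v = ob (val u)].
  have [u uv] := connL v (in_setT v); exists u.
  by have [-> ->] := step_const _ _ uv.
have [pQ cQ _] := Q_part.
have cP : #|preim_partition lab setT| = #|S|.
  pose cls (u : {u : T | u \in S}) := [set y | lab y == lab (val u)].
  have cls_inj : injective cls.
    move=> u u' /setP/(_ (val u)); rewrite !inE eqxx !labS.
    by move=> /esym/eqP/new_blk_inj.
  rewrite -[RHS]card_sig -cardsT -(card_imset _ cls_inj).
  congr #|pred_of_set _|; apply/setP=> B; apply/idP/imsetP.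
    move=> /mem_preim_partition[v ->]; have [u [_ vu _]] := src v.
    by exists u => //; rewrite /cls labS vu.
  move=> [u _ ->]; rewrite /cls -pblock_preim_partition.
  exact: pblock_mem_partitionT (preim_partitionT _).
split; last first.
  split=> [v|]; last exact: pblock_preim_eq.
  (* A label is a block number of [Q], and [Q] has as many blocks as the new partition, namely
     [#|S|]. *)
  have [u [_ -> _]] := src v.
  by rewrite cP -card_Vs -cQ; exact: blkP.1.
split=> //; first exact: preim_partitionT.
move=> _ /mem_preim_partition[v ->]; set B := [set y | _].
have [u [_ vu ovu]] := src v.
have srcB x : x \in B -> connect (spread_step setT lab) (val u) x /\ ob x = ob v.
  rewrite inE vu => /eqP xu; have [w [wx xw ow]] := src x.
  have /new_blk_inj <- : nb w = nb u by rewrite -xw.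
  split=> //; rewrite ow ovu; congr (ob (val _)).
  by apply: new_blk_inj; rewrite -xw.
split.
- rewrite /induced_connected; set r := [rel a b | _].
  have rsym : connect_sym r by exact: induced_connect_sym.
  have conn_u x : x \in B -> connect r (val u) x.
    move=> /srcB[/connectP[p ep ->] _].
    have : val u \in B by rewrite inE labS vu.
    elim: p (val u) ep => [|c p IHp] a //= /andP[/and5P[_ _ ac _ eac] ep] aB.
    have cB : c \in B by move: aB; rewrite !inE (eqP ac).
    by apply: connect_trans (IHp c ep cB); apply: connect1; rewrite /= aB cB.
  move=> x y /conn_u xu /conn_u; apply: connect_trans; by rewrite rsym.
- apply/eqP/cards1P; exists (val u); apply/setP=> x; rewrite !inE.
  apply/andP/eqP => [[xv xS]|->]; last by rewrite labS vu eqxx (valP u).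
  rewrite -[x]/(val (exist _ x xS : {u | u \in S})); congr val.
  by apply: new_blk_inj; rewrite -labS -vu; apply/eqP.
(* The class of [v] is contained in the block of [Q] around [v], whose old vertices weigh at most
   [sp_t I]. *)
have [_ _] := block_supply (old_vertex R v); apply: leq_trans.
rewrite big_mkcond [leqRHS]big_mkcond /=; apply: leq_sum => x _.
by case: ifP => // /srcB[_ /eqP ->].
Qed.

(** The search without a machine: either some edge inside a block leaves [A] and gives a further
    label, or [A] is closed and hence everything. *)
Lemma spread_complete A lab : spread A lab -> exists lab', spread setT lab'.
Proof.
have [k] := ubnP #|~: A|; elim: k A lab => // k IHk A lab leAk sA.
have [/'forall_'forall_implyP clA|] := boolP [forall a, forall b,
    [&& a \in A, edge a b & ob a == ob b] ==> (b \in A)].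
  suff <- : A = setT by exists lab.
  apply: spread_closed_full sA _ => a b aA eab oab.
  by apply: (clA a); rewrite aA eab oab eqxx.
rewrite negb_forall => /existsP[a]; rewrite negb_forall => /existsP[b].
rewrite negb_imply => /andP[/and3P[aA eab /eqP oab] bA].
apply: IHk (spread_extend sA aA bA eab oab).
have := cardsD1 b (~: A); rewrite inE bA => cA.
have -> : ~: (b |: A) = ~: A :\ b by apply/setP=> z; rewrite !inE negb_or.
lia.
Qed.

End Relabel.

Lemma encodes_partition_index (V : finType) (Q : {set {set V}}) :
  partition Q setT -> encodes_partition Q (fun x => index (pblock Q x) (enum Q)).
Proof.
move=> pQ; have memQ x : pblock Q x \in enum Q.
  by rewrite mem_enum pblock_mem_partitionT.
split=> [x|x y]; first by rewrite cardE index_mem.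
split=> [e|->//]; have := nth_index set0 (memQ x); rewrite e => <-; exact: nth_index.
Qed.

Lemma sd_yes_reduction : sd_yes J -> sp_yes I.
Proof.
move=> [Q Q_part]; have [pQ _ _] := Q_part.
have blkP := encodes_partition_index pQ.
set blk := (X in encodes_partition _ X) in blkP.
(* The value 0 outside [S] is a dummy, since only the vertices of [S] count as labelled at the
   start. *)
pose lab0 v := if insub v is Some u then blk (new_vertex u) else 0.
have /(spread_complete Q_part blkP)[lab] : spread blk S lab0.
  by apply: spread_source => u; rewrite /lab0 valK.
by move=> /(spread_tree_S_partition Q_part blkP)[? _]; eexists; eauto.
Qed.

End Pendants.

(** * A program logic for total correctness with step counts *)

Definition wp (p : prog) (m : state) (Q : nat -> state -> Prop) : Prop :=
  exists c m', exec p m c m' /\ Q c m'.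

Section WeakestPrecondition.
Variables (m : state) (Q : nat -> state -> Prop).

Lemma wp_const r x : Q 1 (set_reg m r x) -> wp (Const r x) m Q.
Proof. by move=> Qm; do 2!eexists; split; [apply: ExecConst|]. Qed.

(** Here and below the value that is read is a parameter tied by an equation, so that a proof can
    name it by its meaning in the graph. *)
Lemma wp_move r r1 x : reg m r1 = x -> Q 1 (set_reg m r x) -> wp (Move r r1) m Q.
Proof. by move=> <- Qm; do 2!eexists; split; [apply: ExecMove|]. Qed.

Lemma wp_incr r x : reg m r = x -> Q 1 (set_reg m r x.+1) -> wp (Incr r) m Q.
Proof. by move=> <- Qm; do 2!eexists; split; [apply: ExecIncr|]. Qed.

Lemma wp_read r a i x :
  arr m a (reg m i) = x -> Q 1 (set_reg m r x) -> wp (Read r a i) m Q.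
Proof. by move=> <- Qm; do 2!eexists; split; [apply: ExecRead|]. Qed.

Lemma wp_write a i r k x : reg m i = k -> reg m r = x ->
  Q 1 (set_arr m a k x) -> wp (Write a i r) m Q.
Proof. by move=> <- <- Qm; do 2!eexists; split; [apply: ExecWrite|]. Qed.

Lemma wp_seq p1 p2 :
  wp p1 m (fun c1 m1 => wp p2 m1 (fun c2 => Q (c1 + c2))) ->
  wp (Seq p1 p2) m Q.
Proof.
move=> [c1 [m1 [e1 [c2 [m2 [e2 Qm]]]]]].
by exists (c1 + c2), m2; split=> //; apply: ExecSeq e1 e2.
Qed.

Lemma wp_if_eq r1 r2 x y p1 p2 : reg m r1 = x -> reg m r2 = y ->
  wp (if x == y then p1 else p2) m (fun c => Q c.+1) -> wp (If (Eq r1 r2) p1 p2) m Q.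
Proof.
by move=> <- <- [c [m' [e Qm]]]; exists c.+1, m'; split=> //; apply: ExecIf.
Qed.

Lemma wp_conseq p (Q' : nat -> state -> Prop) :
  wp p m Q' -> (forall c m', Q' c m' -> Q c m') -> wp p m Q.
Proof. by move=> [c [m' [e Qm]]] sub; exists c, m'; split=> //; apply: sub. Qed.

End WeakestPrecondition.

(* [Inv k m] grants the remaining iterations a budget of [k] steps. *)
Lemma wp_while (Inv : nat -> state -> Prop) b p k m :
  (forall k m, Inv k m -> eval_test m b ->
     wp p m (fun c m1 => exists2 k', Inv k' m1 & c + k' < k)) ->
  Inv k m ->
  wp (While b p) m (fun c m' =>
    exists2 k', Inv k' m' /\ eval_test m' b = false & c + k' <= k.+1).
Proof.
move=> body; have [n] := ubnP k; elim: n k m => // n IHn k m lekn Ikm.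
case tb: (eval_test m b); last first.
  by exists 1, m; split; [apply: ExecWhileEnd | exists k].
have [c [m1 [e1 [k1 Ik1 ltk]]]] := body k m Ikm tb.
have [|c2 [m2 [e2 [k2 [Ik2 tb2] le2]]]] := IHn k1 m1 _ Ik1; first lia.
exists (c + c2).+1, m2; split; first exact: ExecWhileLoop e1 e2.
by exists k2 => //; lia.
Qed.

(** * The relabelling program: a queue search from all sources at once *)

Definition r_one := 1.
Definition r_i := 2.
Definition r_tail := 3.
Definition r_head := 4.
Definition r_x := 5.
Definition r_j := 6.
Definition r_end := 7.
Definition r_blk := 8.
Definition r_lab := 9.
Definition r_y := 10.
Definition r_tmp := 11.
(** Separate marks are kept because 0, the initial content of [a_out], is also a legitimate
    label. *)
Definition a_mark := 6.
Definition a_queue := 7.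

Local Notation "p ;; q" := (Seq p q) (at level 60, right associativity).

(** The list of a pendant vertex has its neighbour in [S] as single entry. The pendant vertex is
    marked as well, which makes the later scan pass over it. [Move r_tmp r_tmp] serves as a skip. *)
Definition label_sources_body : prog :=
  Read r_tmp a_supply r_i ;;
  If (Eq r_tmp r_one)
     (Write a_mark r_i r_one ;;
      Read r_y a_off r_i ;;
      Read r_y a_adj r_y ;;
      Read r_lab a_block r_i ;;
      Write a_out r_y r_lab ;;
      Write a_mark r_y r_one ;;
      Write a_queue r_tail r_y ;;
      Incr r_tail)
     (Move r_tmp r_tmp) ;;
  Incr r_i.

Definition scan_body : prog :=
  Read r_y a_adj r_j ;;
  Read r_tmp a_mark r_y ;;
  If (Eq r_tmp r_one)
     (Move r_tmp r_tmp)
     (Read r_tmp a_block r_y ;;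
      If (Eq r_tmp r_blk)
         (Write a_out r_y r_lab ;;
          Write a_mark r_y r_one ;;
          Write a_queue r_tail r_y ;;
          Incr r_tail)
         (Move r_tmp r_tmp)) ;;
  Incr r_j.

(** [r_blk] confines the search to the block of [x] in [Q], while [r_lab] is passed on; they differ
    when the pendant vertex of the source lies in another block. *)
Definition search_body : prog :=
  Read r_x a_queue r_head ;;
  Read r_j a_off r_x ;;
  Move r_end r_x ;;
  Incr r_end ;;
  Read r_end a_off r_end ;;
  Read r_blk a_block r_x ;;
  Read r_lab a_out r_x ;;
  While (Lt r_j r_end) scan_body ;;
  Incr r_head.

Definition relabel : prog :=
  Const r_one 1 ;;
  While (Lt r_i r_size) label_sources_body ;;
  While (Lt r_head r_tail) search_body.

(** * Correctness and linear running time of the program *)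

Section Relabel.
Variables (R : realType) (I : sp_instance).
Variable Q : {set {set sd_tree (reduction R I)}}.
Variables (num : sd_tree (reduction R I) -> nat) (m0 : state).
Hypothesis Q_part : supply_demand_partition Q.
Hypothesis enc : encodes_input Q num m0.

Let T := sp_tree I.
Let S : {set T} := sp_S I.
Let J := reduction R I.
Let n := #|sd_tree J|.
Let blk x := arr m0 a_block (num x).
Let nold (v : T) := num (old_vertex R v).
Let nnew (u : {u : T | u \in S}) := num (new_vertex R u).
Let off v := arr m0 a_off (nold v).
Let deg (v : T) := #|@edge (sd_tree J) (old_vertex R v)|.
Let lab m v := arr m a_out (nold v).

Lemma nold_inj : injective nold.
Proof. by move=> a b /(enc_num_inj enc)/old_vertex_inj. Qed.

Lemma nnew_inj : injective nnew.
Proof. by move=> a b /(enc_num_inj enc)/new_vertex_inj. Qed.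

Lemma nold_eq v w : (nold v == nold w) = (v == w).
Proof. exact: inj_eq nold_inj v w. Qed.

Lemma nold_nnew v u : (nold v == nnew u) = false.
Proof. by apply/eqP => /(enc_num_inj enc). Qed.

Lemma num_surj i : i < n -> exists x, num x = i.
Proof.
move=> ltin; pose f x := Ordinal (enc_num_lt enc x).
have finj : injective f by move=> x y [] /(enc_num_inj enc).
have /codomP[x /(congr1 val)/= ->] : Ordinal ltin \in codom f.
  by apply: inj_card_onto finj _ _; rewrite card_ord.
by exists x.
Qed.

Lemma adj_edge v t : t < deg v -> exists2 y : sd_tree J,
  arr m0 a_adj (off v + t) = num y & @edge (sd_tree J) (old_vertex R v) y.
Proof.
move=> ltt; have : arr m0 a_adj (off v + t) \in
    [seq arr m0 a_adj (off v + j) | j <- iota 0 (deg v)].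
  by apply/mapP; exists t; rewrite ?mem_iota.
rewrite (perm_mem (enc_adj enc (old_vertex R v))) => /mapP[y yE ->].
by exists y => //; rewrite mem_enum in yE.
Qed.

Lemma edge_adj (v w : T) : edge v w ->
  exists2 t, t < deg v & arr m0 a_adj (off v + t) = nold w.
Proof.
move=> evw; have : nold w \in
    [seq num y | y <- enum (@edge (sd_tree J) (old_vertex R v))].
  by apply: map_f; rewrite mem_enum.
rewrite -(perm_mem (enc_adj enc (old_vertex R v))) => /mapP[t].
by rewrite mem_iota => /= ltt ->; exists t.
Qed.

Lemma adj_new u : arr m0 a_adj (arr m0 a_off (nnew u)) = nold (val u).
Proof.
have := enc_adj enc (new_vertex R u).
have -> : enum (@edge (sd_tree J) (new_vertex R u)) = [:: old_vertex R (val u)].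
  rewrite -(enum1 (old_vertex R (val u))); apply: eq_enum => -[w|u'] //=.
have -> : #|@edge (sd_tree J) (new_vertex R u)| = 1.
  rewrite -(card1 (old_vertex R (val u))); apply: eq_card => -[w|u'] //=.
by rewrite /= addn0 => /perm_mem/(_ (nold (val u))); rewrite !inE eqxx => /eqP.
Qed.

(** The list [q] holds all labelled vertices in order of discovery; dequeuing only advances
    [r_head], so [q] never shrinks. *)
Record queued (q : seq T) (m : state) : Prop := Queued {
  q_size : reg m r_size = n;
  q_one : reg m r_one = 1;
  q_input : [/\ arr m a_off = arr m0 a_off, arr m a_adj = arr m0 a_adj,
                arr m a_supply = arr m0 a_supply & arr m a_block = arr m0 a_block];
  q_tail : reg m r_tail = size q;
  q_queue : mkseq (arr m a_queue) (size q) = map nold q;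
  q_uniq : uniq q;
  q_mark : forall v, arr m a_mark (nold v) = (v \in q)
}.

Lemma queued_nth d x r m : queued (d ++ x :: r) m ->
  arr m a_queue (size d) = nold x.
Proof.
move=> qm; have /(congr1 (nth 0 ^~ (size d))) := q_queue qm.
rewrite nth_mkseq; last by rewrite size_cat /=; lia.
by rewrite map_cat nth_cat size_map ltnn subnn.
Qed.

Lemma queued_push q m m' w : queued q m -> w \notin q ->
  reg m' r_size = reg m r_size -> reg m' r_one = reg m r_one ->
  [/\ arr m' a_off = arr m a_off, arr m' a_adj = arr m a_adj,
      arr m' a_supply = arr m a_supply & arr m' a_block = arr m a_block] ->
  reg m' r_tail = (size q).+1 ->
  arr m' a_queue = upd (arr m a_queue) (size q) (nold w) ->
  (forall v, arr m' a_mark (nold v) =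
     if v == w then 1 else arr m a_mark (nold v)) ->
  queued (rcons q w) m'.
Proof.
move=> [sz one [i1 i2 i3 i4] tl que uq mk] wq sz' one' [i1' i2' i3' i4'] tl' que' mk'.
split=> //.
- by rewrite sz'.
- by rewrite one'.
- by rewrite i1' i2' i3' i4'.
- by rewrite size_rcons.
- rewrite size_rcons mkseqS que' map_rcons -que; congr rcons.
    rewrite /mkseq; apply/eq_in_map => k; rewrite mem_iota add0n => /= ltk.
    by rewrite /upd ltn_eqF.
  by rewrite /upd eqxx.
- by rewrite rcons_uniq wq.
move=> v; rewrite mk' mk mem_rcons inE.
by case: eqP.
Qed.

Lemma queued_same q m m' : queued q m ->
  (forall r, r \in [:: r_size; r_one; r_tail] -> reg m' r = reg m r) ->
  arr m' = arr m -> queued q m'.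
Proof.
move=> [sz one inp tl que uq mk] regE arrE.
by split; rewrite ?arrE // regE ?inE.
Qed.

(** The longest pass takes 11 steps, and the loop test makes 12. *)
Definition sources_inv (k : nat) (m : state) : Prop := exists q,
  [/\ queued q m,
      [/\ reg m r_i <= n, reg m r_head = 0 & k = 12 * (n - reg m r_i)],
      forall u, arr m a_mark (nnew u) = (nnew u < reg m r_i),
      forall u, (val u \in q) = (nnew u < reg m r_i) &
      (forall v, v \in q -> v \in S) /\
      (forall u, val u \in q -> lab m (val u) = blk (new_vertex R u))].

Lemma label_sources_bodyP k m : sources_inv k m -> eval_test m (Lt r_i r_size) ->
  wp label_sources_body m (fun c m1 => exists2 k', sources_inv k' m1 & c + k' < k).
Proof.
move=> [q [qm [lein hd ->] mkn memq [qS labq]]] /=; rewrite (q_size qm) => lti.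
have [i1 i2 i3 i4] := q_input qm.
have [x xi] := num_surj lti.
have supx : arr m a_supply (reg m r_i) = (x \in sd_Vs J).
  by rewrite i3 -xi (enc_supply enc).
apply: wp_seq; apply: wp_read supx _.
case: x xi => [v|u] xi; rewrite inE /=; apply: wp_seq.
  apply: (wp_if_eq (x := 0) (y := 1)) => //=;
  first exact: q_one qm.
  apply: wp_move => //; apply: (wp_incr (x := reg m r_i)) => //.
  exists (12 * (n - (reg m r_i).+1)); last lia.
  have noi u : (nnew u < (reg m r_i).+1) = (nnew u < reg m r_i).
    by rewrite ltnS leq_eqVlt -xi eq_sym (nold_nnew v u).
  exists q; split=> //;
    first by apply: queued_same qm _ _ => // r; rewrite !inE => /or3P[]/eqP->.
  - by move=> u; rewrite noi -mkn.
  - by move=> u; rewrite noi -memq.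
have {}xi : nnew u = reg m r_i by [].
apply: (wp_if_eq (x := 1) (y := 1)) => //=;
  first exact: q_one qm.
apply: wp_seq; apply: (wp_write (k := nnew u) (x := 1)) => //;
  first exact: q_one qm.
apply: wp_seq; apply: (wp_read (x := arr m0 a_off (nnew u))); first by rewrite -i1 xi.
apply: wp_seq; apply: (wp_read (x := nold (val u))).
  by rewrite -adj_new -i2.
apply: wp_seq; apply: (wp_read (x := blk (new_vertex R u))).
  by rewrite /blk -i4 -/(nnew u) xi.
apply: wp_seq; apply: (wp_write (k := nold (val u)) (x := blk (new_vertex R u))) => //.
apply: wp_seq; apply: (wp_write (k := nold (val u)) (x := 1)) => //;
  first exact: q_one qm.
apply: wp_seq; apply: (wp_write (k := size q) (x := nold (val u))) => //;
  first exact: q_tail qm.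
apply: (wp_incr (x := size q)); first exact: q_tail qm.
apply: (wp_incr (x := reg m r_i)) => //.
exists (12 * (n - (reg m r_i).+1)); last lia.
(* The pendant vertex of [u] has exactly the current number, so [u] has not been queued yet. *)
have uq : val u \notin q by rewrite memq xi ltnn.
have memS u' : (nnew u' < (reg m r_i).+1) = (u' == u) || (nnew u' < reg m r_i).
  by rewrite ltnS leq_eqVlt -xi (inj_eq nnew_inj).
exists (rcons q (val u)); split.
- apply: queued_push qm uq _ _ _ _ _ _ => // v.
  rewrite /= /upd /= nold_eq; case: eqP => // _.
  by rewrite nold_nnew.
- by split.
- move=> u'; rewrite /= /upd /= eq_sym nold_nnew memS (inj_eq nnew_inj).
  by case: eqP => //= _; rewrite mkn.
- by move=> u'; rewrite mem_rcons inE memq memS val_eqE.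
split=> [v|u']; rewrite mem_rcons inE.
  by move=> /orP[/eqP ->|/qS //]; apply: valP.
rewrite val_eqE /lab /= /upd /= nold_eq val_eqE.
by have [->|_ /labq] := eqVneq u' u.
Qed.

Definition searched (q : seq T) (m : state) : Prop :=
  [/\ queued q m, forall u, arr m a_mark (nnew u) = 1 &
      spread blk [set v in q] (lab m)].

(** Once nothing waits, [q] equals [d] and this is the closure hypothesis of
    [spread_closed_full]. *)
Definition scanned (q d : seq T) : Prop := forall v w, v \in d ->
  edge v w -> blk (old_vertex R v) = blk (old_vertex R w) -> w \in q.

(** The queue splits into a scanned part [d] and a waiting part [r]. Every vertex outside [d],
    discovered or not, holds the budget for its own scan: 12 per list entry and 12 for the
    overhead. *)
Definition search_inv (k : nat) (m : state) : Prop := exists d r,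
  [/\ searched (d ++ r) m, scanned (d ++ r) d, reg m r_head = size d &
      k = \sum_(v | v \notin d) (12 * deg v + 12)].

(** [t] entries of the list of [x] have been read, and the last clause is [scanned] for [x]
    restricted to them; [r] is existential because it grows during the scan. *)
Definition scan_inv (d : seq T) (x : T) (k : nat) (m : state) : Prop :=
  exists r t,
  [/\ searched (d ++ x :: r) m, scanned (d ++ x :: r) d,
      [/\ reg m r_head = size d, reg m r_blk = blk (old_vertex R x) &
          reg m r_lab = lab m x],
      [/\ reg m r_j = off x + t, reg m r_end = off x + deg x, t <= deg x &
          k = 12 * (deg x - t)] &
      forall s w, s < t -> arr m0 a_adj (off x + s) = nold w ->
        blk (old_vertex R x) = blk (old_vertex R w) -> w \in d ++ x :: r].

Lemma searched_same q m m' : searched q m ->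
  (forall r, r \in [:: r_size; r_one; r_tail] -> reg m' r = reg m r) ->
  arr m' = arr m -> searched q m'.
Proof.
move=> [qm mkn sp] regE arrE; split; rewrite /lab ?arrE //.
exact: queued_same qm regE arrE.
Qed.

Lemma scan_bodyP d x k m : scan_inv d x k m -> eval_test m (Lt r_j r_end) ->
  wp scan_body m (fun c m1 => exists2 k', scan_inv d x k' m1 & c + k' < k).
Proof.
move=> [r [t [sm scd [hd rb rl] [rj re let_ ->] seen]]].
rewrite /= rj re ltn_add2l => ltt; have [qm mkn sp] := sm.
have [i1 i2 i3 i4] := q_input qm.
have [y ay exy] := adj_edge ltt.
set q := d ++ x :: r in sm scd seen qm sp.
apply: wp_seq; apply: (wp_read (x := num y)); first by rewrite i2 rj.
(* Common to the three branches that leave the queue alone: the entry just read is pendant, already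
   queued, or in another block. *)
have skip m' :
    (forall r, r \in [:: r_size; r_one; r_tail; r_head; r_blk; r_lab; r_end] ->
       reg m' r = reg m r) -> arr m' = arr m ->
    reg m' r_j = (off x + t).+1 ->
    (forall w, y = old_vertex R w ->
       blk (old_vertex R x) = blk (old_vertex R w) -> w \in q) ->
    scan_inv d x (12 * (deg x - t.+1)) m'.
  move=> regE arrE rj' new; exists r, t.+1; split=> //.
  - apply: searched_same sm _ arrE => s; rewrite !inE => hs; apply: regE.
    by rewrite !inE; case/or3P: hs => ->; rewrite ?orbT.
  - by split; rewrite /lab ?arrE regE // !inE ?eqxx ?orbT.
  - by split; rewrite // ?addnS // regE // !inE ?eqxx ?orbT.
  move=> s w; rewrite ltnS leq_eqVlt => /orP[/eqP ->|]; last exact: seen.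
  by rewrite ay => /(enc_num_inj enc); apply: new.
have regP (m' : state) :
    (reg m' 0 = reg m 0 /\ reg m' 1 = reg m 1 /\ reg m' 3 = reg m 3 /\
     reg m' 4 = reg m 4 /\ reg m' 8 = reg m 8 /\ reg m' 9 = reg m 9 /\
     reg m' 7 = reg m 7) ->
    forall r, r \in [:: r_size; r_one; r_tail; r_head; r_blk; r_lab; r_end] ->
      reg m' r = reg m r.
  move=> [? [? [? [? [? [? ?]]]]]] s.
  by rewrite !inE => /orP[/eqP->//|/orP[/eqP->//|
    /orP[/eqP->//|/orP[/eqP->//|/or3P[]/eqP->//]]]].
case: y ay exy skip => [w|u] ay exy skip; last first.
  apply: wp_seq; apply: (wp_read (x := 1)); first exact: mkn.
  apply: wp_seq; apply: (wp_if_eq (x := 1) (y := 1)) => //=;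
  first exact: q_one qm.
  apply: wp_move => //; apply: (wp_incr (x := off x + t)) => //.
  exists (12 * (deg x - t.+1)); last lia.
  by apply: skip => //; apply: regP.
apply: wp_seq; apply: (wp_read (x := (w \in q))); first exact: q_mark qm w.
apply: wp_seq; apply: (wp_if_eq (x := (w \in q)) (y := 1)) => //;
  first exact: q_one qm.
case wq: (w \in q) => /=.
  apply: wp_move => //; apply: (wp_incr (x := off x + t)) => //.
  exists (12 * (deg x - t.+1)); last lia.
  by apply: skip => // [|w' [<-]]; first apply: regP.
apply: wp_seq; apply: (wp_read (x := blk (old_vertex R w))); first by rewrite /blk -i4.
apply: (wp_if_eq (x := blk (old_vertex R w)) (y := blk (old_vertex R x))) => //.
case: eqP => bwx; last first.
  apply: wp_move => //; apply: (wp_incr (x := off x + t)) => //.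
  exists (12 * (deg x - t.+1)); last lia.
  by apply: skip => // [|w' [<-] /esym]; first apply: regP.
apply: wp_seq; apply: (wp_write (k := nold w) (x := lab m x)) => //.
apply: wp_seq; apply: (wp_write (k := nold w) (x := 1)) => //;
  first exact: q_one qm.
apply: wp_seq; apply: (wp_write (k := size q) (x := nold w)) => //;
  first exact: q_tail qm.
apply: (wp_incr (x := size q)); first exact: q_tail qm.
apply: (wp_incr (x := off x + t)) => //.
exists (12 * (deg x - t.+1)); last lia.
have xq : x \in q by rewrite mem_cat mem_head orbT.
have qw : d ++ x :: rcons r w = rcons q w by rewrite /q rcons_cat.
have subq v : v \in q -> v \in rcons q w by rewrite mem_rcons inE => ->; rewrite orbT.
exists (rcons r w), t.+1; rewrite qw; split=> //.
- split.
  + apply: queued_push qm _ _ _ _ _ _ _ => //; first by rewrite wq.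
    by move=> v; rewrite /= /upd /= nold_eq.
  + by move=> u; rewrite /= /upd /= eq_sym nold_nnew.
  have -> : [set v in rcons q w] = w |: [set v in q].
    by apply/setP=> v; rewrite !inE mem_rcons inE.
  apply: eq_spread (spread_extend (y := w) sp _ _ exy _); rewrite ?inE ?wq //.
  by move=> v; rewrite /lab /= /upd /= nold_eq.
- by move=> v v' vd ev bv; apply: subq; apply: scd bv.
- split=> //; rewrite /lab /= /upd /= nold_eq.
  by case: eqP => // xw; rewrite -xw xq in wq.
- by split=> //; rewrite addnS.
move=> s v; rewrite ltnS leq_eqVlt => /orP[/eqP ->|lts av bv].
  by rewrite ay => /(enc_num_inj enc)/old_vertex_inj <- _; rewrite mem_rcons mem_head.
by apply: subq; apply: seen av bv.
Qed.

Lemma search_bodyP k m : search_inv k m -> eval_test m (Lt r_head r_tail) ->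
  wp search_body m (fun c m1 => exists2 k', search_inv k' m1 & c + k' < k).
Proof.
move=> [d [r [sm scd hd ->]]] /=; have [qm mkn sp] := sm.
rewrite hd (q_tail qm) size_cat; case: r sm scd qm sp => [|x r] sm scd qm sp.
  by rewrite addn0 ltnn.
move=> _; have [i1 i2 i3 i4] := q_input qm.
apply: wp_seq; apply: (wp_read (x := nold x)); first by rewrite hd (queued_nth qm).
apply: wp_seq; apply: (wp_read (x := off x)); first by rewrite /off -i1.
apply: wp_seq; apply: (wp_move (x := nold x)) => //.
apply: wp_seq; apply: (wp_incr (x := nold x)) => //.
apply: wp_seq; apply: (wp_read (x := off x + deg x)).
  by rewrite -(enc_off enc) -i1.
apply: wp_seq; apply: (wp_read (x := blk (old_vertex R x))); first by rewrite /blk -i4.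
apply: wp_seq; apply: (wp_read (x := lab m x)) => //.
apply: wp_seq.
set m1 := set_reg _ r_lab _.
have inv1 : scan_inv d x (12 * deg x) m1.
  exists r, 0; split=> //; last by rewrite addn0 subn0.
  by apply: searched_same sm _ _ => // s; rewrite !inE => /or3P[]/eqP->.
apply: wp_conseq (wp_while (@scan_bodyP d x) inv1) _ => {m1 inv1}.
move=> c m1 [k' [[r' [t [sm1 scd1 [hd1 _ _] [rj re let_ ->] seen]]] /= tst le]].
apply: (wp_incr (x := size d)) => //.
(* The whole list has been read, so [x] may join the scanned part and its share of the budget is
   released. *)
have et : t = deg x.
  apply/eqP; rewrite eqn_leq let_ leqNgt; apply: contraFN tst => ltt.
  by rewrite rj re ltn_add2l.
have uq : uniq (d ++ x :: r) := q_uniq qm.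
have xd : x \notin d.
  by move: uq; rewrite cat_uniq /= negb_or => /and3P[_ /andP[]].
exists (\sum_(v | v \notin rcons d x) (12 * deg v + 12)); last first.
  have -> : \sum_(v | v \notin d) (12 * deg v + 12) = 12 * deg x + 12 +
      \sum_(v | v \notin rcons d x) (12 * deg v + 12).
    rewrite (bigD1 x) //=; congr (_ + _); apply: eq_bigl => v.
    by rewrite mem_rcons inE negb_or andbC.
  lia.
exists (rcons d x), r'; rewrite cat_rcons; split=> //; last by rewrite size_rcons.
  by apply: searched_same sm1 _ _ => // s; rewrite !inE => /or3P[]/eqP->.
move=> v w; rewrite mem_rcons inE => /orP[/eqP->|]; last exact: scd1.
by move=> /edge_adj[s]; rewrite -et; apply: seen.
Qed.

(** The degrees are those in T', which is itself a tree with at most [2 * #|T|] vertices. *)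
Lemma sum_deg : \sum_(v : T) deg v <= 4 * #|T|.
Proof.
have := tree_sum_degree (sd_tree J).
rewrite big_sumType /= => /(leq_trans (leq_addr _ _)).
by move=> /leq_trans; apply; rewrite -[4]/(2 * 2) -mulnA leq_mul2l card_reduction_tree.
Qed.

Lemma relabelP : exists (m' : state) (c : nat) (P : {set {set T}}),
  [/\ exec relabel m0 c m', c <= 100 * #|T|, tree_S_partition P &
      encodes_partition P (lab m')].
Proof.
have blkP : encodes_partition Q blk := enc_block enc.
suff [c [m' [ex [lec sp]]]] : wp relabel m0 (fun c m' =>
    c <= 100 * #|T| /\ spread blk setT (lab m')).
  have [P_part P_enc] := spread_tree_S_partition Q_part blkP sp.
  by exists m', c; eexists; split; eauto.
apply: wp_seq; apply: wp_const; apply: wp_seq.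
set m1 := set_reg _ _ _.
have ri0 : reg m1 r_i = 0 by exact: (enc_reg0 enc (r := r_i)).
have mark0 i : arr m1 a_mark i = 0 by exact: (enc_arr0 enc).
have inv1 : sources_inv (12 * n) m1.
  exists [::]; split; rewrite ?ri0 ?subn0 //.
    by split=> //; [exact: enc_size enc | exact: (enc_reg0 enc (r := r_tail))].
  by split=> //; exact: (enc_reg0 enc (r := r_head)).
apply: wp_conseq (wp_while label_sources_bodyP inv1) _ => {m1 inv1 ri0 mark0}.
move=> c1 m1 [k1 [[q [qm [lei hd ->] mkn memq [qS labq]]] /= tst le1]].
rewrite (q_size qm) in tst.
(* Every vertex number has been visited, so all of [S] is labelled and queued. *)
have ei : reg m1 r_i = n by lia.
have allq (u : {u : T | u \in S}) : val u \in q.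
  by rewrite memq ei; apply: enc_num_lt enc _.
have qE : [set v in q] = S.
  apply/setP=> v; rewrite inE; apply/idP/idP => [/qS //|vS].
  exact: (allq (exist _ v vS)).
have inv2 : search_inv (\sum_v (12 * deg v + 12)) m1.
  exists [::], q; split=> //; split=> //.
    by move=> u; rewrite mkn -memq allq.
  by rewrite qE; apply: spread_source => u; apply: labq.
apply: wp_conseq (wp_while search_bodyP inv2) _.
move=> c2 m2 [k2 [[d [r [[qm2 _ sp2] scd hd2 _]]] /= tst2 le2]].
have r0 : r = [::].
  by apply/nilP; rewrite /nilp; move: tst2; rewrite hd2 (q_tail qm2) size_cat; lia.
rewrite r0 cats0 in sp2 scd.
split.
  (* The loops cost at most [12 * n + 1] and [12 * (\sum_v deg v) + 12 * #|T| + 1] steps, with one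
     more for the constant: at most [84 * #|T| + 3], which is below [100 * #|T|] as T is
     nonempty. *)
  have := sum_deg; have := card_reduction_tree R I; have := tree_nonempty T.
  move: le2; rewrite big_split /= -big_distrr /= sum_nat_const -/T -/J -/n.
  have -> : #|xpredT : pred T| = #|T| by apply: eq_card.
  rewrite -/deg; lia.
suff <- : [set v in d] = setT by [].
apply: spread_closed_full Q_part blkP _ _ sp2 _ => a b.
by rewrite !inE => ad eab /(scd _ _ ad eab).
Qed.

End Relabel.

Theorem theorem5 (R : realType) :
  (forall I : sp_instance, sp_yes I <-> sd_yes (reduction R I)) /\
  (exists (p : prog) (K : nat),
     forall (I : sp_instance) (Q : {set {set sd_tree (reduction R I)}})
            (num : sd_tree (reduction R I) -> nat) (m : state),
       supply_demand_partition Q -> encodes_input Q num m ->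
       exists (m' : state) (c : nat) (P : {set {set sp_tree I}}),
         [/\ exec p m c m',
             (c <= K * #|sp_tree I|)%N,
             tree_S_partition P &
             encodes_partition P (fun v => arr m' a_out (num (old_vertex R v)))]).
Proof.
split=> [I|].
  by split; [apply: sp_yes_reduction | apply: sd_yes_reduction].
by exists relabel, 100 => I Q num m; apply: relabelP.
Qed.
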